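(* (i) Let $P$ be an oriented knot projection on $S^2$ with crossing number $c(P)=n\ge 1$, and let $Z_P(t)=\sum_D X_D(t)$ be the state sum of $P$, where the sum runs over all $2^n$ states $D$ for $P$ and $X_D(t)$ is the warping crossing polynomial of $D$. Then $$Z_P(t)=2n(1+t)^{n-1}.$$ (ii) Let $D$ be an oriented knot diagram on $S^2$, and let $D'$ be the oriented knot diagram obtained from $D$ by a crossing change at a crossing point $p$ of $D$. Then $$X_D(t)-tX_{D'}(t)=(1-t)A,$$ where $A$ is the sum of $t^{d(e)}$ over all edges $e$ of $D$ that are traversed when going along $D$, following the orientation, from the under-crossing of $p$ to the over-crossing of $p$ (here $d(e)$ is computed in $D$).
   Context: A knot projection is the image of a closed curve on $S^2$ whose only singularities are finitely many transverse double points; a knot diagram is a knot projection together with over/under information at each double point (crossing point). Projections and diagrams are oriented. $c(\cdot)$ denotes the number of crossing points. An edge of a diagram or projection is an arc of the curve running between two consecutive passages through crossing points (so there are $2n$ edges when there are $n\ge 1$ crossings). A based diagram $D_b$ is a diagram $D$ with a base point $b$ on $D$ that is not a crossing point. A crossing point of $D$ is a warping crossing point of $D_b$ if, when going along $D$ following its orientation starting from $b$, one meets that crossing point first as an under-crossing. The warping degree $d(D_b)$ is the number of warping crossing points of $D_b$. For an edge $e$ of $D$, $d(e)$ denotes $d(D_b)$ with $b$ any point in the interior of $e$. For a crossing point $c$ of $D$, $d(c)=d(D_b)$ where $b$ is a base point just before the over-crossing of $c$ (with respect to the orientation). The warping crossing polynomial of $D$ is $X_D(t)=\sum_c t^{d(c)}$,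 the sum over all crossing points $c$ of $D$. A state for a projection $P$ with $n$ double points is any of the $2^n$ oriented knot diagrams obtained from $P$ by choosing over/under information at each double point. *)

(* Defs.v *)
From HB Require Import structures.
From mathcomp Require Import all_boot all_order all_algebra.
From mathcomp Require Import finmap lra.
From mathcomp Require Import all_classical all_reals all_analysis.
Import Order.TTheory GRing.Theory Num.Theory.
Import numFieldNormedType.Exports.

Set Implicit Arguments.
Unset Strict Implicit.
Unset Printing Implicit Defensive.

Local Open Scope classical_set_scope.
Local Open Scope ring_scope.

(* Points of the circle R/Z are represented by the parameters in [0, 1[. *)
Definition param {R : realType} (t : R) : bool := 0 <= t < 1.

(* The unique element of [0, 1[ congruent to t - s modulo 1: the distance
   travelled on R/Z when going from s to t in the positive direction. *)
Definition offset {R : realType} (s t : R) : R :=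
  if s <= t then t - s else t - s + 1.

Definition crossing_set {R : realType} (g : R -> 'rV[R]_3) : set 'rV[R]_3 :=
  [set x | exists s t, [/\ param s, param t, s != t, g s = x & g t = x]].

(* An oriented knot projection on S^2 is given by an oriented regular C^1
   parametrization by R/Z of the curve. *)
Record projection (R : realType) := Projection {
  curve :> R -> 'rV[R]_3;
  curve_sphere : forall t, \sum_i curve t 0 i ^+ 2 = 1;
  curve_periodic : forall t, curve (t + 1) = curve t;
  curve_derivable : forall t, derivable curve t 1;
  curve_C1 : continuous (derive1 curve);
  curve_regular : forall t, derive1 curve t != 0;
  curve_finite : finite_set (crossing_set curve);
  curve_double : forall s t u, param s -> param t -> param u ->
    curve s = curve t -> curve t = curve u -> [|| s == t, t == u | s == u];
  curve_transverse : forall s t, param s -> param t -> s != t ->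
    curve s = curve t -> free [:: derive1 curve s; derive1 curve t] }.

Section Projection.
Context {R : realType}.
Implicit Type P : projection R.

Definition crossing P : finType := fset_set (crossing_set P).

Definition crossing_number P : nat := #|crossing P|.

Definition passage_set P : set R :=
  [set t | param t /\ crossing_set P (P t)].

Lemma finite_passage_set P : finite_set (passage_set P).
Proof.
have sub : passage_set P `<=`
    \bigcup_(x in crossing_set P) [set t | param t /\ P t = x].
  by move=> t [pt ct]; exists (P t).
apply: (sub_finite_set sub); apply: bigcup_finite; first exact: curve_finite.
move=> x [s [t [ps pt st Ps Pt]]].
apply: (@sub_finite_set _ _ [set s; t]); last first.
  by rewrite finite_setU; split; exact: finite_set1.
move=> u [pu Pu].
have := @curve_double _ P s t u ps pt pu.
rewrite Ps Pt Pu => /(_ erefl erefl); rewrite (negbTE st) /=.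
by move=> /orP[/eqP ->|/eqP ->]; [right|left].
Qed.

(* A passage of the curve through a crossing point, i.e. a parameter. *)
Definition passage P : finType := fset_set (passage_set P).

Lemma passageP P (s : passage P) : passage_set P (val s).
Proof.
have := valP s; rewrite in_fset_set ?inE //; exact: finite_passage_set.
Qed.

Definition through P (c : crossing P) (s : passage P) : bool :=
  P (val s) == val c.

Lemma crossing_passages P (c : crossing P) :
  exists s t, s != t /\ through c =i [set s; t]%SET.
Proof.
have : crossing_set P (val c).
  have := valP c; rewrite in_fset_set ?inE //; exact: curve_finite.
move=> [s [t [ps pt st Ps Pt]]].
have cx : crossing_set P (val c) by exists s, t.
have ins r : param r -> P r = val c -> r \in fset_set (passage_set P).
  move=> pr Pr; rewrite in_fset_set ?inE; last exact: finite_passage_set.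
  by split; rewrite ?Pr.
exists (FSetSub (ins s ps Ps)), (FSetSub (ins t pt Pt)); split.
  by rewrite -val_eqE.
move=> u; rewrite !inE /through -!val_eqE /= unfold_in /=.
apply/eqP/orP => [Pu|[/eqP->|/eqP->]//].
have [pu _] := passageP u.
have := @curve_double _ P s t (val u) ps pt pu.
rewrite Ps Pt Pu => /(_ erefl erefl); rewrite (negbTE st) /= => /orP.
by move=> [/eqP->|/eqP->]; [right|left].
Qed.

Definition base_point P (b : R) : Prop := param b /\ ~ crossing_set P (P b).

(* Over/under information is given by the set of over-crossing passages,
   which contains exactly one of the two passages through each crossing
   point.  The inhabitants of [diagram P] are exactly the states for P. *)
Record diagram P := Diagram {
  over_set : {set passage P};
  over_setP : [forall c, #|[set s in over_set | through c s]%SET| == 1%N] }.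

HB.instance Definition _ P := [isSub for @over_set P].
HB.instance Definition _ P := [Finite of diagram P by <:].

Lemma over_exists P (D : diagram P) (c : crossing P) :
  exists s, (s \in over_set D) && through c s.
Proof.
have /forallP/(_ c)/cards1P [s Ds] := over_setP D.
by exists s; have := set11 s; rewrite -Ds !inE.
Qed.

Lemma under_exists P (D : diagram P) (c : crossing P) :
  exists s, (s \notin over_set D) && through c s.
Proof.
have /forallP/(_ c)/cards1P [w wE] := over_setP D.
have [s [t [st E]]] := crossing_passages c.
have inD (r : passage P) : r \in over_set D -> through c r -> r = w.
  by move=> rD rc; apply/set1P; rewrite -wE inE rD.
have sc : through c s by have := E s; rewrite !inE eqxx.
have tc : through c t by have := E t; rewrite !inE eqxx orbT.
have [sD|sD] := boolP (s \in over_set D); last by exists s; rewrite sD.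
exists t; rewrite tc andbT; apply/negP => tD.
by move: st; rewrite (inD s) // (inD t) // eqxx.
Qed.

Definition over P (D : diagram P) (c : crossing P) : passage P :=
  xchoose (over_exists D c).

Definition under P (D : diagram P) (c : crossing P) : passage P :=
  xchoose (under_exists D c).

Definition warping_crossing P (D : diagram P) (b : R) (c : crossing P) : bool :=
  offset b (val (under D c)) < offset b (val (over D c)).

Definition warping_degree P (D : diagram P) (b : R) : nat :=
  #|[set c | warping_crossing D b c]%SET|.

(* Open arc of R/Z from s to t in the positive direction; empty if s = t. *)
Definition arc (s t : R) : set R :=
  [set b | param b /\ 0 < offset s b < offset s t].

(* The edge running from the passage e.1 to the next passage e.2. *)
Definition is_edge P (e : passage P * passage P) : bool :=
  (e.1 != e.2) && [forall r : passage P, val r \notin arc (val e.1) (val e.2)].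

Definition edge_interior P (e : passage P * passage P) : set R :=
  arc (val e.1) (val e.2).

Definition edge_degree P (D : diagram P) (e : passage P * passage P) : nat :=
  warping_degree D (xget 0 (edge_interior e)).

(* b is just before s: s is the first passage met when starting from b. *)
Definition just_before P (s : passage P) : set R :=
  [set b | base_point P b /\
    forall r : passage P, offset b (val s) <= offset b (val r)].

Definition crossing_degree P (D : diagram P) (c : crossing P) : nat :=
  warping_degree D (xget 0 (just_before (over D c))).

Definition warping_crossing_poly P (D : diagram P) : {poly int} :=
  \sum_(c : crossing P) 'X^(crossing_degree D c).

Definition state_sum P : {poly int} :=
  \sum_(D : diagram P) warping_crossing_poly D.

Definition crossing_change_set P (D : diagram P) (p : crossing P) :
    {set passage P} :=
  [set s | (s \in over_set D) (+) through p s]%SET.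

Lemma crossing_change_subproof P (D : diagram P) (p : crossing P) :
  [forall c,
    #|[set s in crossing_change_set D p | through c s]%SET| == 1%N].
Proof.
set O := crossing_change_set D p; apply/forallP => c.
have /forallP/(_ c) := over_setP D.
have [->|cp] := eqVneq c p; last first.
  suff -> : [set s in O | through c s]%SET =
            [set s in over_set D | through c s]%SET by [].
  apply/setP => s; rewrite !inE; case sc : (through c s); last by rewrite !andbF.
  suff -> : through p s = false by rewrite addbF.
  apply/negP => /eqP ps; move/eqP: sc; rewrite ps => /val_inj pc.
  by rewrite pc eqxx in cp.
have [s [t [st E]]] := crossing_passages p.
move=> /eqP card1; apply/eqP.
have : (#|[set s in over_set D | through p s]%SET| +
        #|[set s in O | through p s]%SET| = 2)%N.
  have <- : #|[set s in through p]%SET| = 2%N.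
    rewrite -[RHS](_ : #|[set s; t]%SET| = 2%N); last by rewrite cards2 st.
    by apply: eq_card => r; rewrite inE E.
  rewrite -(cardsID (over_set D) [set s in through p]%SET).
  congr addn; apply: eq_card => r; rewrite !inE ?[r \in through p]unfold_in.
    by rewrite andbC.
  by rewrite /through; case: (P _ == _); rewrite ?addbT ?andbT ?andbF.
by rewrite card1 => -[].
Qed.

Definition crossing_change P (D : diagram P) (p : crossing P) : diagram P :=
  Diagram (crossing_change_subproof D p).

(* An edge is traversed between the two passages through p iff its interior
   lies in the arc of R/Z between them. *)
Definition under_over_sum P (D : diagram P) (p : crossing P) : {poly int} :=
  \sum_(e : passage P * passage P | is_edge e &&
      `[< edge_interior e `<=` arc (val (under D p)) (val (over D p)) >])
    'X^(edge_degree D e).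

Lemma passage_param P (s : passage P) : 0 <= val s < 1.
Proof. by have [ps _] := passageP s; exact: ps. Qed.

Lemma offset_param (s t : R) :
  0 <= s < 1 -> 0 <= t < 1 -> 0 <= offset s t < 1.
Proof. by rewrite /offset; case: (leP s t) => ? ? ?; lra. Qed.

Lemma offsetE (s x u : R) : 0 <= s < 1 -> 0 <= x < 1 -> 0 <= u < 1 ->
  offset x u = offset (offset s x) (offset s u).
Proof.
move=> ps px pu; rewrite /offset.
by case: (leP s x) => ?; case: (leP s u) => ?; case: (leP x u) => ?;
  case: (leP _ _) => ?; lra.
Qed.

Lemma offset_lt (T a b v w : R) : 0 < a < T -> 0 < b < T ->
  0 <= v < 1 -> 0 <= w < 1 -> ~~ (0 < v < T) -> ~~ (0 < w < T) ->
  offset a v < offset a w -> offset b v < offset b w.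
Proof.
move=> aT bT v01 w01; rewrite !negb_and -!leNgt => /orP hv /orP hw.
rewrite /offset; case: (leP a v) => ?; case: (leP a w) => ?;
  case: (leP b v) => ?; case: (leP b w) => ?; try lra;
  by case: hv => ?; case: hw => ?; lra.
Qed.

Lemma offset_add (x o u : R) : 0 <= x < 1 -> 0 <= o < 1 -> 0 <= u < 1 ->
  offset x o <= offset x u -> offset x u = offset x o + offset o u.
Proof.
move=> px po pu; rewrite /offset.
by case: (leP x o) => ?; case: (leP x u) => ?; case: (leP o u) => ? ?; lra.
Qed.

(* The degrees do not depend on the choice of the base point. *)

Lemma edge_degreeE P (D : diagram P) (e : passage P * passage P) (b : R) :
  is_edge e -> edge_interior e b -> edge_degree D e = warping_degree D b.
Proof.
move=> /andP[_ /forallP eE] eb.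
have : edge_interior e (xget 0 (edge_interior e)) by apply: xgetPex; exists b.
rewrite /edge_degree; move: (xget _ _) => b' eb'.
apply: eq_card => c; rewrite !inE /warping_crossing.
move: (eE (under D c)) (eE (over D c)) eb eb'.
rewrite !notin_setE /edge_interior.
have := passage_param (under D c); have := passage_param (over D c).
have := passage_param e.1; have := passage_param e.2.
move: (val e.1) (val e.2) (val (over D c)) (val (under D c)) => s t o u.
move=> pt ps po pu nu no [pb hb] [pb' hb'].
have {}nu : ~~ (0 < offset s u < offset s t) by apply/negP => h; exact: nu.
have {}no : ~~ (0 < offset s o < offset s t) by apply/negP => h; exact: no.
have key (x y : R) : 0 <= x < 1 -> 0 <= y < 1 ->
    0 < offset s x < offset s t -> 0 < offset s y < offset s t ->
    offset x u < offset x o -> offset y u < offset y o.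
  move=> px py hx hy; rewrite (offsetE ps px pu) (offsetE ps px po).
  rewrite (offsetE ps py pu) (offsetE ps py po).
  by apply: (offset_lt hx hy) => //; exact: offset_param.
by apply/idP/idP; apply: key.
Qed.

Lemma crossing_degreeE P (D : diagram P) (c : crossing P) (b : R) :
  just_before (over D c) b -> crossing_degree D c = warping_degree D b.
Proof.
move=> cb; rewrite /crossing_degree.
have : just_before (over D c) (xget 0 (just_before (over D c))).
  by apply: xgetPex; exists b.
move: (xget _ _) => b' cb'.
have key (x : R) : just_before (over D c) x -> forall r : passage P,
    offset x (val r) =
    offset x (val (over D c)) + offset (val (over D c)) (val r).
  move=> [[px _] hx] r.
  by apply: offset_add (hx r) => //; exact: passage_param.
apply: eq_card => c'; rewrite !inE /warping_crossing.
rewrite (key _ cb' (under D c')) (key _ cb' (over D c')).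
by rewrite (key _ cb (under D c')) (key _ cb (over D c')) !ltrD2l.
Qed.

End Projection.

(* Main.v *)
(* Reading the degree just before each passage s of the curve gives a function
   d on the 2n cyclically ordered passages: the degree of an edge is d at its
   end, the degree of a crossing point is d at its over-passage.

   (i) For a fixed passage s, a state is determined by its set of warping
   crossing points seen from s, which is arbitrary; s is an over-passage iff
   its crossing point is not in that set.  Hence the states over at s
   contribute the sum of t^|W| over all sets W avoiding one crossing point,
   that is (1 + t)^(n - 1).

   (ii) Going past s raises d by one if s is over and lowers it by one if s is
   under, while the crossing change at p raises d by one on the passages after
   the under-passage u of p up to its over-passage o, and lowers it by one
   elsewhere.  So over-passages outside [u, o] cancel on the left, those
   strictly inside contribute (1 - t^2) t^d, and p contributes
   t^d(o) - t^d(u), a telescoping sum over the passages from u to o; the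
   identity then holds passage by passage. *)
Require Import Defs.
From mathcomp Require Import all_boot all_order all_algebra.
From mathcomp Require Import all_classical all_reals all_analysis.
From mathcomp Require Import finmap lra ring.
Import Order.TTheory GRing.Theory Num.Theory.
(* [arc] and [over] are shadowed by library names. *)
Import Defs.
Local Open Scope ring_scope.

Set Implicit Arguments.
Unset Strict Implicit.
Unset Printing Implicit Defensive.

(* [lra] spends its time comparing offsets up to conversion unless they are
   turned into variables first. *)
Ltac offset_lra :=
  repeat match goal with H : forall _, _ |- _ => clear H end;
  repeat match goal with H : context [offset _ _] |- _ => revert H end;
  repeat match goal with
  | |- context [offset ?a ?b] => generalize (offset a b); intro
  end;
  intros; lra.

(** * Offsets on the circle R/Z *)

Lemma offset_inj (R : realType) (a x y : R) :
  0 <= a < 1 -> 0 <= x < 1 -> 0 <= y < 1 -> offset a x = offset a y -> x = y.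
Proof.
move=> ? ? ?; rewrite /offset.
by case: (leP a x) => ?; case: (leP a y) => ? ?; lra.
Qed.

Lemma offset_refl (R : realType) (a : R) : offset a a = 0.
Proof. by rewrite /offset lexx subrr. Qed.

Lemma offset_swap (R : realType) (a x : R) :
  a != x -> offset a x + offset x a = 1.
Proof. by rewrite /offset; case: (ltgtP a x) => // ? _; lra. Qed.

(** The differences cancel, so only the numbers of wraps past 0 matter: the detour through [b] costs
    at most one full turn. This dichotomy reduces questions of cyclic order to linear arithmetic. *)
Lemma offset_cocycle (R : realType) (a b c : R) :
  offset a b + offset b c = offset a c \/
  offset a b + offset b c = offset a c + 1.
Proof.
rewrite /offset; case: (leP a b) => ?; case: (leP b c) => ?;
  case: (leP a c) => ?; first [by left; lra | by right; lra | exfalso; lra].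
Qed.

Lemma arc_nonempty (R : realType) (s t : R) :
  0 <= s < 1 -> 0 <= t < 1 -> s != t -> exists b, arc s t b.
Proof.
move=> ps pt; case: (ltgtP s t) => // st _.
  exists ((s + t) / 2); split; rewrite /param /offset; first by lra.
  by case: (leP s ((s + t) / 2)) => ?; case: (leP s t) => ?; lra.
(* This arc wraps past 0: the witness is the midpoint of [s] and [t + 1], brought back below 1 when
   necessary. *)
have [h|h] := ltP ((s + t + 1) / 2) 1.
  exists ((s + t + 1) / 2); split; rewrite /param /offset; first by lra.
  by case: (leP s ((s + t + 1) / 2)) => ?; case: (leP s t) => ?; lra.
exists ((s + t - 1) / 2); split; rewrite /param /offset; first by lra.
by case: (leP s ((s + t - 1) / 2)) => ?; case: (leP s t) => ?; lra.
Qed.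

(** * Counting and polynomial identities *)

Lemma card_toggle (T : finType) (x : T) (A B : {set T}) :
  (forall y, (y \in B) = (y \in A) (+) (y == x)) -> x \notin A ->
  #|B| = #|A|.+1.
Proof.
move=> AB xA; suff -> : B = (x |: A)%SET by rewrite cardsU1 xA.
apply/setP => y; rewrite AB !inE addbC.
by case: eqVneq => [->|]; rewrite ?(negbTE xA).
Qed.

(** Expand the product over [y] of [F y + 1]: the weight 0 at [x] kills the subsets containing [x]
    and makes the factor at [x] equal to 1. *)
Lemma sum_subsets_avoiding (T : finType) (x : T) :
  \sum_(W : {set T} | x \notin W) 'X^#|W| = (1 + 'X) ^+ #|T|.-1 :> {poly int}.
Proof.
pose F (y : T) : {poly int} := if y == x then 0 else 'X.
have := @bigA_distr _ 0 1 *%R +%R _ F (fun=> 1).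
move=> E; transitivity (\prod_y (F y + 1)).
  rewrite E big_mkcond; apply: eq_bigr => W _.
  rewrite -big_mkcond /=.
  have [xW|xW] /= := boolP (x \in W).
    by rewrite (bigD1 x) //= /F eqxx mul0r.
  rewrite (eq_bigr (fun=> 'X)) ?prodr_const // => y yW.
  by rewrite /F; case: eqVneq => // yx; rewrite -yx yW in xW.
rewrite (bigD1 x) //= {1}/F eqxx add0r mul1r.
rewrite (eq_bigr (fun=> 1 + 'X)) => [|y yx].
  rewrite prodr_const; congr (_ ^+ _).
  by rewrite -(cardC1 x); apply: eq_card.
by rewrite /F (negbTE yx) addrC.
Qed.

(** Contribution of an under-passage to the skein relation; [q] is the monomial of the degree just
    after it. *)
Lemma skein_under (A : comNzRingType) (x q : A) : (1 - x) * q - (q - x * q) = 0.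
Proof. ring. Qed.

(** Contribution of an over-passage strictly between the passages of [p]; [q] is the monomial of the
    degree just before it. *)
Lemma skein_over (A : comNzRingType) (x q : A) :
  (1 - x) * (x * q) - (x * q - q) = q - x * (x * q).
Proof. ring. Qed.

Section Passages.
Context {R : realType} {P : projection R}.
Implicit Types (s t r u o : passage P) (c p : crossing P) (D : diagram P).

Let pp s : 0 <= val s < 1 := passage_param s.

(** * The pairing of passages at crossing points *)

Lemma crossing_of_subproof s : P (val s) \in fset_set (crossing_set P).
Proof.
rewrite in_fset_set; last exact: curve_finite.
by have [_ /mem_set] := passageP s.
Qed.

Definition crossing_of s : crossing P := FSetSub (crossing_of_subproof s).

Lemma throughE c s : through c s = (crossing_of s == c).
Proof. by rewrite -val_eqE. Qed.

Lemma crossing_of_fiber c : exists x y, x != y /\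
  forall r, (crossing_of r == c) = (r == x) || (r == y).
Proof.
have [x [y [xy E]]] := crossing_passages c; exists x, y; split=> // r.
by have := E r; rewrite !inE -throughE => <-.
Qed.

Lemma twin_exists s : exists t, (t != s) && (crossing_of t == crossing_of s).
Proof.
have [x [y [xy Et]]] := crossing_of_fiber (crossing_of s).
have := Et s; rewrite eqxx => /esym/orP[] /eqP sE.
  by exists y; rewrite Et eqxx orbT sE eq_sym xy.
by exists x; rewrite Et eqxx sE xy.
Qed.

(** Fibres of [crossing_of] have two elements, so the choice is forced. *)
Definition twin s : passage P := xchoose (twin_exists s).

Lemma twin_neq s : twin s != s.
Proof. by have /andP[] := xchooseP (twin_exists s). Qed.

Lemma crossing_of_twin s : crossing_of (twin s) = crossing_of s.
Proof. by have /andP[_ /eqP] := xchooseP (twin_exists s). Qed.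

Lemma crossing_of_eq s t :
  (crossing_of t == crossing_of s) = (t == s) || (t == twin s).
Proof.
have [x [y [xy Et]]] := crossing_of_fiber (crossing_of s).
rewrite Et.
have := Et s; have := Et (twin s); rewrite crossing_of_twin eqxx.
move: (twin_neq s) => ns /esym/orP[] /eqP tE /esym/orP[] /eqP sE;
  move: ns; rewrite tE sE ?eqxx //.
by rewrite orbC.
Qed.

Lemma twinK : involutive twin.
Proof.
move=> s; have := crossing_of_eq s (twin (twin s)).
rewrite !crossing_of_twin eqxx (negbTE (twin_neq _)) orbF.
by move=> /esym/eqP.
Qed.

Lemma crossing_of_surj c : exists s, crossing_of s = c.
Proof.
have [x [y [_ E]]] := crossing_of_fiber c.
by exists x; apply/eqP; rewrite E eqxx.
Qed.

Lemma card_passage : #|passage P| = (2 * crossing_number P)%N.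
Proof.
rewrite -sum1_card (partition_big crossing_of predT) //=.
rewrite (eq_bigr (fun=> 2%N)) => [|c _].
  by rewrite sum_nat_const mulnC.
have [s <-] := crossing_of_surj c.
rewrite sum1_card; transitivity #|[set s; twin s]%SET|.
  by apply: eq_card => t; rewrite !inE -crossing_of_eq.
by rewrite cards2 eq_sym twin_neq.
Qed.

(** * Over- and under-passages of a diagram *)

Lemma overP D c : (over D c \in over_set D) /\ crossing_of (over D c) = c.
Proof.
by have /andP[? ] := xchooseP (over_exists D c); rewrite throughE => /eqP.
Qed.

Lemma underP D c : (under D c \notin over_set D) /\ crossing_of (under D c) = c.
Proof.
by have /andP[? ] := xchooseP (under_exists D c); rewrite throughE => /eqP.
Qed.

Lemma over_crossing_of D s : s \in over_set D -> over D (crossing_of s) = s.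
Proof.
move=> sD; have [oD oE] := overP D (crossing_of s).
have /forallP/(_ (crossing_of s))/cards1P [w wE] := over_setP D.
have inw t : t \in over_set D -> crossing_of t = crossing_of s -> t = w.
  by move=> tD tE; apply/set1P; rewrite -wE inE tD throughE tE eqxx.
by rewrite (inw _ oD oE) (inw s).
Qed.

Lemma underE D c : under D c = twin (over D c).
Proof.
have [uD uE] := underP D c; have [oD oE] := overP D c.
have := crossing_of_eq (over D c) (under D c); rewrite uE oE eqxx.
by move=> /esym/orP[] /eqP // uo; rewrite uo oD in uD.
Qed.

Lemma over_twin D s : (twin s \in over_set D) = (s \notin over_set D).
Proof.
have [sD|sD] /= := boolP (s \in over_set D).
  apply/negP => /over_crossing_of; rewrite crossing_of_twin over_crossing_of //.
  by move=> /esym/eqP; rewrite (negbTE (twin_neq s)).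
have [oD oE] := overP D (crossing_of s).
have := crossing_of_eq s (over D (crossing_of s)); rewrite oE eqxx.
by move=> /esym/orP[] /eqP E; rewrite E ?(negbTE sD) in oD *.
Qed.

Lemma under_crossing_of D s : 
  s \notin over_set D -> under D (crossing_of s) = s.
Proof.
move=> sD; rewrite underE -crossing_of_twin over_crossing_of ?twinK //.
by rewrite over_twin.
Qed.

Lemma sum_over (V : nmodType) D (F : passage P -> V) :
  \sum_c F (over D c) = \sum_(s | s \in over_set D) F s.
Proof.
rewrite (reindex_onto (over D) crossing_of) /=; last exact: over_crossing_of.
by apply: eq_bigl => c; have [-> ->] := overP D c; rewrite eqxx.
Qed.

Lemma diagram_exists (S : {set passage P}) :
  (forall s, (twin s \in S) = (s \notin S)) -> exists D, over_set D = S.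
Proof.
move=> St; suff SP : [forall c, #|[set s in S | through c s]%SET| == 1%N].
  by exists (Diagram SP).
apply/forallP => c.
have [s [sS <-]] : exists s, s \in S /\ crossing_of s = c.
  have [s <-] := crossing_of_surj c.
  have [sS|sS] := boolP (s \in S); first by exists s.
  by exists (twin s); rewrite St sS crossing_of_twin.
apply/cards1P; exists s; apply/setP => t; rewrite !inE throughE crossing_of_eq.
apply/andP/eqP => [[tS /orP[] /eqP // tE]|->]; last by rewrite eqxx.
by rewrite tE St sS in tS.
Qed.

(** * States as sets of warping crossing points *)

Definition warping_set D s : {set crossing P} :=
  [set c | warping_crossing D (val s) c]%SET.

(** The starting point is the passage itself, at offset 0, hence met first, as from a base point
    just before it; [warping_degree_before] shows that the degrees agree. *)
Definition degree_at D s : nat := warping_degree D (val s).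

Lemma degree_atE D s : degree_at D s = #|warping_set D s|.
Proof. by []. Qed.

Lemma offset_eq s t r :
  (offset (val s) (val t) == offset (val s) (val r)) = (t == r).
Proof.
apply/eqP/eqP => [h|->//]; apply: val_inj.
exact: offset_inj (pp s) (pp t) (pp r) h.
Qed.

Lemma offset_ge0 s t : 0 <= offset (val s) (val t).
Proof. by have /andP[] := offset_param (pp s) (pp t). Qed.

Lemma offset_gt0 s t : (0 < offset (val s) (val t)) = (t != s).
Proof. by rewrite lt0r offset_ge0 andbT -(offset_refl (val s)) offset_eq. Qed.

Lemma offset_passage_swap s t : s != t ->
  offset (val s) (val t) + offset (val t) (val s) = 1.
Proof. by rewrite -val_eqE => /offset_swap. Qed.

Lemma warping_over D s t : t \in over_set D ->
  (crossing_of t \in warping_set D s) =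
  (offset (val s) (val (twin t)) < offset (val s) (val t)).
Proof.
by move=> tD; rewrite inE /warping_crossing underE over_crossing_of.
Qed.

Lemma offset_twin s t :
  (offset (val s) (val (twin t)) < offset (val s) (val t)) =
  ~~ (offset (val s) (val t) < offset (val s) (val (twin t))).
Proof.
by rewrite -leNgt lt_neqAle offset_eq twin_neq.
Qed.

Lemma warping_at D s :
  (crossing_of s \in warping_set D s) = (s \notin over_set D).
Proof.
have [sD|sD] /= := boolP (s \in over_set D).
  by rewrite warping_over // offset_refl ltNge offset_ge0.
by rewrite -crossing_of_twin warping_over ?over_twin // twinK offset_refl
  offset_gt0 twin_neq.
Qed.

(** A crossing point warps when its under-passage comes first, so its warping status and the order
    of its two passages tell which one is over. A state is thus recovered from its warping set. *)
Lemma over_setE D s t :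
  (t \in over_set D) = ((crossing_of t \in warping_set D s) ==
    (offset (val s) (val (twin t)) < offset (val s) (val t))).
Proof.
have [tD|tD] := boolP (t \in over_set D).
  by rewrite warping_over // eqxx.
rewrite -crossing_of_twin warping_over ?over_twin // twinK.
by rewrite (offset_twin s t); case: (_ < _).
Qed.

Lemma warping_set_inj s : injective (warping_set ^~ s).
Proof.
move=> D D' E; apply: val_inj; apply/setP => t /=.
by rewrite (over_setE D s) (over_setE D' s) E.
Qed.

Lemma warping_set_surj s (W : {set crossing P}) : exists D, warping_set D s = W.
Proof.
(* The only candidate compatible with [over_setE]. *)
pose S := [set t | (crossing_of t \in W) ==
    (offset (val s) (val (twin t)) < offset (val s) (val t))]%SET.
have [t|D DS] := @diagram_exists S.
  rewrite !inE crossing_of_twin twinK (offset_twin s t).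
  by case: (_ \in W); case: (_ < _).
exists D; apply/setP => c; have [cD <-] := overP D c.
rewrite warping_over //; move: cD; rewrite DS inE => /eqP ->.
by [].
Qed.

Lemma warping_set_bij s : bijective (warping_set ^~ s).
Proof.
have [g gK] := choice (warping_set_surj s).
by exists g => // D; apply: (@warping_set_inj s); rewrite gK.
Qed.

(** * Successive passages, edges and base points *)

Definition next s : passage P :=
  [arg min_(r < twin s | r != s) offset (val s) (val r)]%O.

Lemma next_neq s : next s != s.
Proof. by rewrite /next; case: arg_minP => //; exact: twin_neq. Qed.

Lemma next_min s r : r != s ->
  offset (val s) (val (next s)) <= offset (val s) (val r).
Proof.
by rewrite /next; case: arg_minP => [|i _ h]; [exact: twin_neq|exact: h].
Qed.

Lemma offset_lt1 s t : offset (val s) (val t) < 1.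
Proof. by have /andP[] := offset_param (pp s) (pp t). Qed.

Lemma next_min_or s r :
  offset (val s) (val r) = 0 \/
  offset (val s) (val (next s)) <= offset (val s) (val r).
Proof.
by case: (eqVneq r s) => [->|/next_min]; [left; exact: offset_refl|right].
Qed.

Lemma is_edgeE s t : is_edge (s, t) = (t == next s).
Proof.
rewrite /is_edge /= eq_sym; apply/andP/eqP => [[ts /forallP h]|->].
  apply/eqP; rewrite -(offset_eq s) eq_le next_min // andbT leNgt.
  have := h (next s); rewrite notin_setE => hn; apply/negP => lt.
  apply: hn; split; first exact: pp.
  by rewrite lt offset_gt0 next_neq.
rewrite next_neq; split=> //; apply/forallP => r; rewrite notin_setE.
move=> [_ /andP[]]; rewrite offset_gt0 => rs.
by rewrite ltNge next_min.
Qed.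

(** If two passages shared a successor, each would lie beyond the successor of the other, so both
    cocycles would wrap; the two offsets between them would then add up to 2 instead of 1. *)
Lemma next_inj : injective next.
Proof.
move=> s s' E; apply/eqP/negPn/negP => ss'.
have := next_min ss'; have := @next_min s s'; rewrite eq_sym ss' -E.
move=> /(_ isT).
have := offset_gt0 s' (next s); rewrite E next_neq -E.
have := offset_gt0 s (next s); rewrite next_neq.
have := offset_passage_swap ss'.
have := offset_cocycle (val s) (val s') (val (next s)).
have := offset_cocycle (val s') (val s) (val (next s)).
have := offset_lt1 s' (next s); have := offset_lt1 s (next s).
by move=> {E}? ? [] ? [] ? ? ? ? ? ?; offset_lra.
Qed.

Lemma arc_next_min s b : arc (val s) (val (next s)) b ->
  forall r, offset b (val (next s)) <= offset b (val r).
Proof.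
move=> [pb /andP[b0 bt]] r.
have := offset_cocycle (val s) b (val r).
have := offset_cocycle (val s) b (val (next s)).
have /andP[? ?] := offset_param pb (pp (next s)).
have /andP[? ?] := offset_param pb (pp r).
have := next_min_or s r; have := offset_lt1 s (next s).
by move=> ? [] ? [] ? [] ?; offset_lra.
Qed.

Lemma base_point_arc_next s b : arc (val s) (val (next s)) b -> base_point P b.
Proof.
move=> [pb /andP[b0 bt]]; split=> // cb.
have ib : b \in fset_set (passage_set P).
  rewrite in_fset_set; last exact: finite_passage_set.
  by apply: mem_set.
have := next_min_or s (FSetSub ib); rewrite [\val (FSetSub ib)]/=.
by case=> ?; offset_lra.
Qed.

(** Offsets from [b] are offsets from [t] shifted by a constant, which leaves every comparison
    unchanged. *)
Lemma warping_degree_before D t b : param b ->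
  (forall r, offset b (val t) <= offset b (val r)) ->
  warping_degree D b = degree_at D t.
Proof.
move=> pb bt; apply: eq_card => c; rewrite !inE /warping_crossing.
have key r : offset b (val r) = offset b (val t) + offset (val t) (val r).
  exact: offset_add (bt r).
by rewrite (key (under D c)) (key (over D c)) ltrD2l.
Qed.

Lemma arc_next_nonempty s : exists b, arc (val s) (val (next s)) b.
Proof. by apply: arc_nonempty => //; rewrite eq_sym val_eqE next_neq. Qed.

Lemma edge_degree_next D s : edge_degree D (s, next s) = degree_at D (next s).
Proof.
have [b sb] := arc_next_nonempty s.
rewrite (@edge_degreeE _ _ D (s, next s) b) ?is_edgeE //.
by apply: warping_degree_before; [case: sb|exact: arc_next_min].
Qed.

Lemma crossing_degree_over D c : crossing_degree D c = degree_at D (over D c).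
Proof.
(* The edge ending at the over-passage supplies a base point just before it, so that [xget] does not
   fall back on its default 0. *)
have [prev _ nextK] := injF_bij next_inj.
have [b sb] := arc_next_nonempty (prev (over D c)).
have := arc_next_min sb; have := base_point_arc_next sb; rewrite nextK => hb bm.
rewrite (@crossing_degreeE _ _ D c b) //.
by apply: warping_degree_before; case: hb.
Qed.

Lemma warping_crossing_polyE D :
  warping_crossing_poly D = \sum_(s | s \in over_set D) 'X^(degree_at D s).
Proof.
by rewrite -sum_over; apply: eq_bigr => c _; rewrite crossing_degree_over.
Qed.

(** * Variation of the degree along the curve and under a crossing change *)

(** Going past [s] moves it from first to last place and keeps the order of all other passages, so
    only its own crossing point is affected. *)
Lemma warping_next D s c :
  (c \in warping_set D (next s)) =
  (c \in warping_set D s) (+) (c == crossing_of s).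
Proof.
have key (x : passage P) : x != s -> offset (val s) (val x) =
    offset (val s) (val (next s)) + offset (val (next s)) (val x).
  by move=> xs; apply: offset_add (next_min xs) => //; exact: pp.
have last (x : passage P) : x != s ->
    offset (val (next s)) (val x) < offset (val (next s)) (val s).
  move=> xs; have := key _ xs; have := offset_lt1 s x.
  have := offset_passage_swap (next_neq s).
  by move=> ? ? ?; offset_lra.
case: eqVneq => [->|cs].
  rewrite warping_at addbT negbK inE /warping_crossing.
  have [sD|sD] := boolP (s \in over_set D).
    rewrite underE over_crossing_of //.
    by apply: last; exact: twin_neq.
  rewrite under_crossing_of // ltNge le_eqVlt last ?orbT //.
  by apply: contraNneq sD => <-; have [] := overP D (crossing_of s).
rewrite addbF !inE /warping_crossing.
have us : under D c != s.
  by apply: contraNneq cs => <-; have [_ ->] := underP D c.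
have os : over D c != s.
  by apply: contraNneq cs => <-; have [_ ->] := overP D c.
by rewrite (key _ us) (key _ os) ltrD2l.
Qed.

Lemma degree_next_over D s : s \in over_set D ->
  degree_at D (next s) = (degree_at D s).+1.
Proof.
move=> sD; rewrite !degree_atE; apply: card_toggle (warping_next D s) _.
by rewrite warping_at sD.
Qed.

Lemma degree_next_under D s : s \notin over_set D ->
  degree_at D s = (degree_at D (next s)).+1.
Proof.
move=> sD; rewrite !degree_atE; apply: (@card_toggle _ (crossing_of s)) => [c|].
  by rewrite warping_next addbK.
by rewrite warping_next warping_at sD eqxx.
Qed.

Lemma over_set_change D p s :
  (s \in over_set (crossing_change D p)) =
  (s \in over_set D) (+) (crossing_of s == p).
Proof. by rewrite inE throughE. Qed.

Lemma warping_change D p s c :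
  (c \in warping_set (crossing_change D p) s) =
  (c \in warping_set D s) (+) (c == p).
Proof.
have [t <-] := crossing_of_surj c.
have := over_setE (crossing_change D p) s t; rewrite over_set_change.
rewrite (over_setE D s t).
by case: (_ < _); case: (_ == p); case: (_ \in _); case: (_ \in _).
Qed.

Lemma degree_change_nonwarping D p s : p \notin warping_set D s ->
  degree_at (crossing_change D p) s = (degree_at D s).+1.
Proof.
by rewrite !degree_atE; apply: card_toggle => c; exact: warping_change.
Qed.

Lemma degree_change_warping D p s : p \in warping_set D s ->
  degree_at D s = (degree_at (crossing_change D p) s).+1.
Proof.
move=> pW; rewrite !degree_atE; apply: (@card_toggle _ p) => [c|].
  by rewrite warping_change addbK.
by rewrite warping_change pW eqxx.
Qed.

(** * The arc from the under-passage to the over-passage *)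

(** The interval is open at the under-passage and closed at the over-passage because a passage used
    as starting point is itself met first. *)
Lemma warping_iff D p s : (p \in warping_set D s) =
  ~~ (0 < offset (val (under D p)) (val s)
        <= offset (val (under D p)) (val (over D p))).
Proof.
rewrite inE /warping_crossing underE; move: (over D p) => o.
have := twin_neq o; move: (twin o) => u uo.
have h1 := offset_cocycle (val u) (val s) (val o).
have h2 := offset_cocycle (val u) (val s) (val u).
move: h2; rewrite offset_refl => h2.
have ? := offset_ge0 u o; have ? := offset_ge0 u s.
have ? := offset_ge0 s o; have ? := offset_ge0 s u.
have ? := offset_lt1 s o; have ? := offset_lt1 s u.
have ? := offset_lt1 u o; have ? := offset_lt1 u s.
have : 0 < offset (val u) (val o) by rewrite offset_gt0 eq_sym.
move=> ?; apply/idP/idP => [lt|].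
  by apply/negP => /andP[? ?]; case: h1 => ?; case: h2 => ?; offset_lra.
rewrite negb_and -!leNgt -!ltNge => /orP[] ?;
  by case: h1 => ?; case: h2 => ?; offset_lra.
Qed.

(** [next] carries the passages of [u, o[ onto those of ]u, o], since no passage is skipped. *)
Lemma next_between u o s : u != o ->
  (offset (val u) (val s) < offset (val u) (val o)) =
  (0 < offset (val u) (val (next s)) <= offset (val u) (val o)).
Proof.
move=> uo.
have h1 := offset_cocycle (val u) (val s) (val o).
have h2 := offset_cocycle (val u) (val s) (val u).
have h3 := offset_cocycle (val u) (val s) (val (next s)).
have m1 := next_min_or s o; have m2 := next_min_or s u.
move: h2; rewrite offset_refl => h2.
have : 0 < offset (val u) (val o) by rewrite offset_gt0 eq_sym.
have : 0 < offset (val s) (val (next s)) by rewrite offset_gt0 next_neq.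
have ? := offset_ge0 u s; have ? := offset_ge0 u (next s).
have ? := offset_ge0 s o; have ? := offset_ge0 s u.
have ? := offset_lt1 s o; have ? := offset_lt1 s u.
have ? := offset_lt1 s (next s); have ? := offset_lt1 u (next s).
have ? := offset_lt1 u o; have ? := offset_lt1 u s.
move=> ? ?; apply/idP/idP => [?|/andP[? ?]].
  have ? : offset (val s) (val (next s)) <= offset (val s) (val o).
    by case: m1 => // ?; case: h1 => ?; offset_lra.
  by case: h1 => ?; case: h3 => ?; offset_lra.
rewrite ltNge; apply/negP => ?.
have ? : offset (val s) (val (next s)) <= offset (val s) (val u).
  by case: m2 => // ?; case: h2 => ?; offset_lra.
by case: h2 => ?; case: h3 => ?; offset_lra.
Qed.

(** An edge has no passage in its interior, so it cannot straddle [u] or [o], and the position of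
    its start decides. *)
Lemma edge_between u o s :
  (edge_interior (s, next s) `<=` arc (val u) (val o))%classic <->
  offset (val u) (val s) < offset (val u) (val o).
Proof.
have ? := offset_ge0 u s; have ? := offset_lt1 u s.
have ? := offset_ge0 s u; have ? := offset_lt1 s u.
have ? := offset_ge0 s o; have ? := offset_lt1 s o.
have ? := offset_ge0 u o; have ? := offset_lt1 u o.
split=> [sub|lt b]; last first.
  rewrite /edge_interior [(s, _).1]/= [(s, _).2]/= => -[pb /andP[b0 bt]].
  split=> //.
  have := offset_cocycle (val u) (val s) b.
  have := offset_cocycle (val u) (val s) (val o).
  have := next_min_or s o; have := offset_lt1 s (next s).
  have /andP[? ?] := offset_param (pp u) pb.
  by move=> ? [] ? [] ? [] ?; offset_lra.
have [b sb] := arc_next_nonempty s; have [_ /andP[? ?]] := sub _ sb.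
case: sb => pb /andP[? ?]; rewrite ltNge; apply/negP => ?.
have := offset_cocycle (val u) (val s) b.
have := offset_cocycle (val u) (val s) (val u); rewrite offset_refl.
have := next_min_or s u; have := offset_lt1 s (next s).
by move=> ? [] ? [] ? [] ?; offset_lra.
Qed.

Lemma under_over_sumE D p : under_over_sum D p =
  \sum_(s | offset (val (under D p)) (val s)
              < offset (val (under D p)) (val (over D p)))
    'X^(degree_at D (next s)).
Proof.
rewrite /under_over_sum.
rewrite (reindex_onto (fun s => (s, next s)) fst) => [|[s t]] /=; last first.
  by rewrite is_edgeE => /andP[/eqP -> _].
apply: eq_big => [s|s _]; last by rewrite edge_degree_next.
rewrite is_edgeE !eqxx andbT /=.
by apply/asboolP/idP => /edge_between.
Qed.

(** * The state sum and the skein relation *)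

Lemma state_sumE :
  state_sum P = (1 + 'X) ^+ (crossing_number P).-1 *+ #|passage P|.
Proof.
rewrite /state_sum (eq_bigr _ (fun D _ => warping_crossing_polyE D)).
rewrite (exchange_big_dep predT) //= -sumr_const; apply: eq_bigr => s _.
rewrite -(sum_subsets_avoiding (crossing_of s)).
(* The sum over subsets is pulled back to a sum over states. *)
rewrite (reindex (warping_set^~ s)) /=; last first.
  by apply: onW_bij; exact: warping_set_bij.
by apply: eq_bigl => D; rewrite warping_at negbK.
Qed.

(** Reindexing by [next] turns the first half into a sum over ]u, o]; against the sum over [u, o[
    only the endpoints survive. *)
Lemma sum_next_telescope D u o : u != o ->
  \sum_(s | offset (val u) (val s) < offset (val u) (val o))
    ('X^(degree_at D (next s)) - 'X^(degree_at D s)) =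
  'X^(degree_at D o) - 'X^(degree_at D u) :> {poly int}.
Proof.
move=> uo; rewrite big_split sumrN /=.
rewrite (eq_bigl _ _ (fun s => next_between s uo)).
rewrite -[X in X + _](reindex_inj next_inj (P := fun s =>
  0 < offset (val u) (val s) <= offset (val u) (val o))
  (F := fun s => 'X^(degree_at D s))) /=.
rewrite (bigD1 o) /=; last by rewrite offset_gt0 eq_sym uo lexx.
rewrite [X in _ - X](bigD1 u) /=; last first.
  by rewrite offset_refl offset_gt0 eq_sym.
rewrite opprD addrACA -[RHS]addr0; congr (_ + _).
apply/eqP; rewrite subr_eq0; apply/eqP; apply: eq_bigl => s.
rewrite offset_gt0 lt_neqAle offset_eq.
by case: (s == u); case: (s == o); rewrite ?andbF ?andbT.
Qed.

Lemma warping_skein D p :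
  warping_crossing_poly D - 'X * warping_crossing_poly (crossing_change D p)
  = (1 - 'X) * under_over_sum D p.
Proof.
rewrite !warping_crossing_polyE under_over_sumE.
have [oD op] := overP D p; have [uD up] := underP D p.
have W := warping_iff D p.
set o := over D p in oD op W *; set u := under D p in uD up W *.
have uo : u != o by apply: contraNneq uD => ->.
have ucr s : (crossing_of s == p) = (s == u) || (s == o).
  by rewrite -op crossing_of_eq /u underE -/o orbC.
(* The crossing point [p] is over at [o] in [D] and at [u] after the change. Seen from [u] it warps
   in [D], so the factor ['X] restores the degree at [u] in [D]. *)
rewrite (bigD1 o) //= [X in 'X * X](bigD1 u) /=; last first.
  by rewrite over_set_change (negbTE uD) up eqxx.
rewrite mulrDr -exprS -degree_change_warping; last first.
  by rewrite W offset_refl ltxx.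
rewrite opprD addrACA -(sum_next_telescope D uo).
(* With the telescoping sum moved to the side of the edge sum, both sides become sums over passages,
   to be compared term by term. *)
rewrite [LHS]addrC; apply/esym/eqP; rewrite -subr_eq; apply/eqP/esym.
rewrite [X in _ = X - _]mulr_sumr -sumrB mulr_sumr.
rewrite [X in _ - X](eq_bigl (fun s => (s \in over_set D) && (s != o)));
  last first.
  move=> s; rewrite over_set_change ucr.
  case: (eqVneq s u) => [->|]; first by rewrite (negbTE uD).
  by case: (eqVneq s o) => [->|]; rewrite ?oD ?addbF ?andbT.
rewrite -sumrB big_mkcond [RHS]big_mkcond; apply: eq_bigr => s _ /=.
have [sD|sD] /= := boolP (s \in over_set D); last first.
  by case: ifP => // _; rewrite (degree_next_under sD) exprS skein_under.
have su : s != u by apply: contraNneq uD => <-.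
have := W s; rewrite offset_gt0 su /= -ltNge => Ws.
rewrite (degree_next_over sD).
case: (eqVneq s o) => [->|so] /=; first by rewrite ltxx.
(* Beyond [o] the two monomials cancel; before [o] the change raises the degree and [skein_over]
   applies; equality would force [s] to be [o]. *)
move: Ws; case: ltgtP => [lt|gt|/eqP uso] Ws.
- by rewrite (degree_change_warping (p := p)) ?Ws // exprS subrr.
- by rewrite degree_change_nonwarping ?Ws // !exprS skein_over.
- by rewrite offset_eq eq_sym (negbTE so) in uso.
Qed.

End Passages.

Theorem theorem1p1 (R : realType) :
  (forall (P : projection R) (n : nat),
     crossing_number P = n -> (1 <= n)%N ->
     state_sum P = (2 * n)%:R * (1 + 'X) ^+ (n - 1)) /\
  (forall (P : projection R) (D : diagram P) (p : crossing P),
     warping_crossing_poly D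
       - 'X * warping_crossing_poly (crossing_change D p)
     = (1 - 'X) * under_over_sum D p).
Proof.
split=> [P n <- _|P D p]; last exact: warping_skein.
by rewrite state_sumE card_passage subn1 mulr_natl.
Qed.
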